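(* For $j=2,8$ and every $n\ge 3$ the genus distribution of ${\cal S}_j^n$ is unimodal. Writing $p_j(n)$ for the peak of the genus distribution of ${\cal S}_j^n$, one has $$p_2(n)=\begin{cases}\Big[\dfrac{n-1}{2}\Big], & 3\le n\le 8,\\[2mm] 3, & n=9,\\[1mm] \Big[\dfrac{n}{3}\Big]+1, & n\ge 10,\end{cases}$$ and $$p_8(n)=\begin{cases}\Big[\dfrac{n+1}{2}\Big], & 3\le n\le 8,\\[2mm] 4, & n=9,\\[1mm] \Big[\dfrac{n}{3}\Big]+2, & n\ge 10.\end{cases}$$
   Context: $[x]$ denotes the largest integer not exceeding $x$. A surface is represented by a cyclic word in which every occurring letter $x$ appears exactly once as $x$ and exactly once as $x^-$; it is the closed orientable surface obtained from a polygon with boundary labelled by the word by identifying each side $x$ with the side $x^-$ (orientation reversed), and its genus is the genus of that surface. Let $a,b,a_1,a_2,\dots$ be distinct letters. For $n\ge 1$ and subsets $K,T\subseteq\{1,\dots,n\}$ put: $R_1^n$ = product of the letters $a_k$, $k\in K$, in decreasing order of index; $R_2^n$ = product of the $a_k$, $k\notin K$, in increasing order of index; $R_3^n$ = product of the $a_t^-$, $t\in T$, in decreasing order of index; $R_4^n$ = product of the $a_t^-$, $t\notin T$, in increasing order of index. The sets of ladder surfaces considered are ${\cal S}_2^n=\{R_1^nR_2^nR_4^nR_3^n\}$ and ${\cal S}_8^n=\{R_1^nR_2^naR_3^na^-bR_4^nb^-\}$, where $(K,T)$ runs over all $4^n$ pairs of subsets and surfaces are counted with multiplicity (one for each pair).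 The genus distribution of ${\cal S}_j^n$ is the sequence $(g_{i_j}(n))_i$, where $g_{i_j}(n)$ is the number of surfaces of genus $i$ in ${\cal S}_j^n$ and $i$ runs from the minimum to the maximum genus. A finite sequence of nonnegative numbers $\{a_i\}_{i=q}^n$ is unimodal if $a_q\le\cdots\le a_{l-1}<a_l=\cdots=a_m>a_{m+1}\ge\cdots\ge a_n$ for some $q\le l\le m\le n$; if $l=m$, then $m$ is called the peak (indices are genera). *)

(* Defs.v *)
From HB Require Import structures.
From mathcomp Require Import all_boot all_order all_algebra.

Set Implicit Arguments.
Unset Strict Implicit.
Unset Printing Implicit Defensive.

Inductive letter := La | Lb | Lk of nat.

Definition letter_code (x : letter) : option (option nat) :=
  match x with La => None | Lb => Some None | Lk k => Some (Some k) end.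

Definition letter_decode (c : option (option nat)) : letter :=
  match c with None => La | Some None => Lb | Some (Some k) => Lk k end.

Lemma letter_codeK : cancel letter_code letter_decode.
Proof. by case. Qed.

HB.instance Definition _ := Equality.copy letter (can_type letter_codeK).

(* A side (x, false) is the letter x, and (x, true) is its inverse x^-. *)
Definition side := (letter * bool)%type.

Definition pos_side (x : letter) : side := (x, false).
Definition neg_side (x : letter) : side := (x, true).

Definition inv_side (s : side) : side := (s.1, ~~ s.2).

(* A cyclic word is represented by any of its linear readings. *)
Definition word := seq side.

Section Surface.

Variable w : word.

(* Side i of the polygon runs from corner i to corner i + 1 (mod size w). *)
Definition side_at (i : 'I_(size w)) : side := tnth (in_tuple w) i.

Definition identified (i j : 'I_(size w)) : bool :=
  side_at i == inv_side (side_at j).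

(* Identified sides are glued with orientation reversed: the initial corner of
   the one is glued to the final corner of the other.  Corner v is the final
   corner of side v - 1, and the second disjunct makes the relation symmetric. *)
Definition glued (u v : 'I_(size w)) : bool :=
  identified u (ord_pred v) || identified v (ord_pred u).

Definition nb_vertices : nat := n_comp glued predT.
Definition nb_edges : nat := (size w)./2.

(* The polygon is the only face. *)
Definition euler_char : int := (nb_vertices%:Z - nb_edges%:Z + 1)%R.

(* For a closed connected orientable surface, euler_char = 2 - 2 * genus. *)
Definition genus : nat := (`|(2 - euler_char)%R|%N)./2.

End Surface.

(* The element k : 'I_n stands for the index k + 1 in {1, ..., n}, and enum
   lists a set of ordinals in increasing order. *)
Definition a_ n (k : 'I_n) : letter := Lk k.+1.

Definition R1 n (K : {set 'I_n}) : word :=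
  [seq pos_side (a_ k) | k <- rev (enum K)].
Definition R2 n (K : {set 'I_n}) : word :=
  [seq pos_side (a_ k) | k <- enum (~: K)].
Definition R3 n (T : {set 'I_n}) : word :=
  [seq neg_side (a_ t) | t <- rev (enum T)].
Definition R4 n (T : {set 'I_n}) : word :=
  [seq neg_side (a_ t) | t <- enum (~: T)].

Definition S2_word n (K T : {set 'I_n}) : word :=
  R1 K ++ R2 K ++ R4 T ++ R3 T.

Definition S8_word n (K T : {set 'I_n}) : word :=
  R1 K ++ R2 K ++ [:: pos_side La] ++ R3 T ++ [:: neg_side La]
    ++ [:: pos_side Lb] ++ R4 T ++ [:: neg_side Lb].

(* Sets of surfaces are counted with multiplicity, hence are lists of words. *)
Definition S2 (n : nat) : seq word :=
  [seq S2_word KT.1 KT.2 | KT : {set 'I_n} * {set 'I_n}].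
Definition S8 (n : nat) : seq word :=
  [seq S8_word KT.1 KT.2 | KT : {set 'I_n} * {set 'I_n}].

Definition genus_count (S : seq word) (i : nat) : nat :=
  count (fun w => genus w == i) S.

Definition max_genus (S : seq word) : nat := \max_(w <- S) genus w.

(* The default max_genus S only matters for empty S. *)
Definition min_genus (S : seq word) : nat :=
  \big[minn/max_genus S]_(w <- S) genus w.

(* The sequence f q, ..., f r is unimodal, its maximum being attained exactly
   at l, ..., m. *)
Definition unimodal_at (f : nat -> nat) (q r l m : nat) : Prop :=
  [/\ q <= l, l <= m & m <= r] /\
  [/\ forall i, q <= i -> i.+1 < l -> f i <= f i.+1,
      q < l -> f l.-1 < f l,
      forall i, l <= i <= m -> f i = f m,
      m < r -> f m.+1 < f m &
      forall i, m < i -> i < r -> f i.+1 <= f i].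

Definition unimodal (f : nat -> nat) (q r : nat) : Prop :=
  exists l m, unimodal_at f q r l m.

Definition is_peak (f : nat -> nat) (q r p : nat) : Prop :=
  unimodal_at f q r p p.

Definition genus_distribution_unimodal (S : seq word) : Prop :=
  unimodal (genus_count S) (min_genus S) (max_genus S).

Definition genus_distribution_peak (S : seq word) (p : nat) : Prop :=
  is_peak (genus_count S) (min_genus S) (max_genus S) p.

Definition p2 (n : nat) : nat :=
  if n <= 8 then (n - 1) %/ 2 else if n == 9 then 3 else n %/ 3 + 1.

Definition p8 (n : nat) : nat :=
  if n <= 8 then (n + 1) %/ 2 else if n == 9 then 4 else n %/ 3 + 2.

(* Main.v *)
Require Import Defs.
From HB Require Import structures.
From mathcomp Require Import all_boot ssralg ssrnum ssrint zify.

(** Read the polygon as a one-vertex ribbon graph, so that the vertices of the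
    surface become its faces.  The letters are inserted in the order
    [a_n, ..., a_1]: [a_k] goes into the gap between R1 and R2, and its
    inverse goes into one of two further gaps, right of R3 or left of R4.  An
    inserted pair splits a face, which keeps the genus, or merges two faces,
    which raises it by one.  Which of these happens depends only on how the
    three gaps are distributed over the faces, and in which cyclic order; this
    gives a six-state transfer system, which S2 and S8 enter in different
    states.

    Solving it, the number of words of genus [i] in S2, for [n = m + 1], is
    four times
      [(2^(m+i-1) - 8^(i-1)) u(m,i-1) + 8^i u(m,i)],
    where [u(m,i) = C(m-i,i) + C(m-1-i,i)], and S8 has the same distribution
    shifted by one.  With [s = m - 2i], the successive ratios of [u] turn the
    difference of two consecutive terms into a polynomial inequality in [i],
    [s] and [2^s], whose sign changes between [s = i - 1] and [s = i - 2], that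
    is at [i = n/3], except for small [n]. *)

Set Implicit Arguments.
Unset Strict Implicit.
Unset Printing Implicit Defensive.

(** * Faces of a word as cycles of sides *)

Section Faces.

Variables (T : eqType) (inv : T -> T).
Hypothesis invK : involutive inv.

(** A corner is encoded by the side that ends there and the side that starts there; seeding
    [pairmap] with the last side closes the word cyclically. *)
Definition corners (w : seq T) : seq (T * T) :=
  if w is x :: s then pairmap pair (last x s) w else [::].

(* A face is listed as the cycle of the sides that start at its corners.  If [t]
   follows [s] in it, then [inv t] precedes [s] in the word, so consecutive
   entries of faces correspond to the corners of the polygon.  A side fixed by
   [inv] only marks a corner: it is inserted into a face without changing the
   number of faces. *)
Definition face_corners (F : seq (seq T)) : seq (T * T) :=
  [seq (inv q.2, q.1) | q <- flatten [seq corners c | c <- F]].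

Definition faces_of (w : seq T) (F : seq (seq T)) : bool :=
  perm_eq (face_corners F) (corners w).

Lemma count_corners_rot p A B :
  count p (corners (A ++ B)) = count p (corners (B ++ A)).
Proof.
case: A B => [|a A] [|b B]; rewrite ?cats0 //=.
by rewrite !last_cat !pairmap_cat /= !count_cat /=; lia.
Qed.

Lemma corners_rot A B : perm_eq (corners (A ++ B)) (corners (B ++ A)).
Proof. by apply/permP => p; apply: count_corners_rot. Qed.

Lemma faces_of_rot A B F : faces_of (A ++ B) F = faces_of (B ++ A) F.
Proof. by rewrite /faces_of; apply: permPr; apply: corners_rot. Qed.

Lemma unzip2_corners w : unzip2 (corners w) = w.
Proof.
case: w => // a s; rewrite [corners _]/=; move: (last a s) => b.
by elim: s a b => [|c s IHs] a b //=; rewrite -[in RHS](IHs _ a).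
Qed.

Lemma perm_unzip1_corners w : perm_eq (unzip1 (corners w)) w.
Proof.
case: w => // a s; rewrite [corners _]/= /unzip1 map_cons.
have -> : [seq i.1 | i <- pairmap pair a s] = belast a s.
  by elim: s a => [|c s IHs] a //=; rewrite IHs.
by rewrite /= -perm_rcons -lastI.
Qed.

Lemma corners_mem w p x : (p, x) \in corners w -> p \in w /\ x \in w.
Proof.
move=> px; split; last by rewrite -(unzip2_corners w); apply: (map_f snd px).
by rewrite -(perm_mem (perm_unzip1_corners w)); apply: (map_f fst px).
Qed.

Lemma corners_injl w p q x : uniq w ->
  (p, x) \in corners w -> (q, x) \in corners w -> p = q.
Proof.
rewrite -[in uniq _](unzip2_corners w) => Uw pw qw.
suff [] : (p, x) = (q, x) by [].
have := nth_index (p, x) pw; have := nth_index (p, x) qw => {1}<- {1}<-.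
congr nth; apply/eqP; rewrite -(nth_uniq x _ _ Uw) ?size_map ?index_mem //.
by rewrite !(nth_map (p, x)) ?index_mem // !nth_index.
Qed.

Lemma corners_injr w p x y : uniq w ->
  (p, x) \in corners w -> (p, y) \in corners w -> x = y.
Proof.
rewrite -(perm_uniq (perm_unzip1_corners w)) => Uw xw yw.
suff [] : (p, x) = (p, y) by [].
have := nth_index (p, x) xw; have := nth_index (p, x) yw => {1}<- {1}<-.
congr nth; apply/eqP; rewrite -(nth_uniq x _ _ Uw) ?size_map ?index_mem //.
by rewrite !(nth_map (p, x)) ?index_mem // !nth_index.
Qed.

Lemma mem_face_corners w F s t : faces_of w F ->
  (s, t) \in flatten [seq corners c | c <- F] -> (inv t, s) \in corners w.
Proof.
by move=> /perm_mem <- st; apply/mapP; exists (s, t).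
Qed.

(** As the sides are distinct, either side of a corner determines the other. Hence a cut of a face
    is located by knowing one of its two neighbours, which is why the conditions on cuts below are
    disjunctions. *)
Lemma corner_match w F p q s t : uniq w -> faces_of w F ->
    (p, q) \in corners w -> (s, t) \in flatten [seq corners c | c <- F] ->
  q = s \/ p = inv t -> inv t = p /\ s = q.
Proof.
move=> Uw wF pq /(mem_face_corners wF) st [e | e]; split=> //.
- by rewrite e in pq; apply: corners_injl st pq.
- by rewrite -e in st; apply: corners_injr st pq.
Qed.

Lemma perm_faces w F G :
    (forall p, count p (flatten [seq corners c | c <- F]) =
       count p (flatten [seq corners c | c <- G])) ->
  faces_of w F -> faces_of w G.
Proof.
move=> eqFG; rewrite /faces_of => /permPr <-; apply/permP => p.
by rewrite !count_map eqFG.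
Qed.

(** [C] is listed so that it closes up at the corner between [A] and [B], and [D] at the corner
    between [B] and [A]. Each of these corners becomes two, and the four new corners link [C] and
    [D] through [x] and [inv x] into one cycle. *)
Lemma merge_faces z x A B C D F :
    A != [::] -> B != [::] -> C != [::] -> D != [::] -> uniq (A ++ B) ->
    head z B = last z C \/ last z A = inv (head z C) ->
    head z A = last z D \/ last z B = inv (head z D) ->
    faces_of (A ++ B) [:: C, D & F] ->
  faces_of (A ++ x :: B ++ [:: inv x]) ((x :: C ++ inv x :: D) :: F).
Proof.
case: A B C D => [|a A] [|b B] [|c C] [|d D] // _ _ _ _ Uw /= Hx Hy wF.
have [ec lc] : inv c = last a A /\ last c C = b.
  apply: (corner_match Uw wF) => //.
    by rewrite /= last_cat pairmap_cat !(in_cons, mem_cat) eqxx !orbT.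
  by rewrite /= !(in_cons, mem_cat) eqxx.
have [ed ld] : inv d = last b B /\ last d D = a.
  apply: (corner_match Uw wF) => //.
    by rewrite /= last_cat !(in_cons, mem_cat) eqxx.
  by rewrite /= !(in_cons, mem_cat) eqxx !orbT.
move: wF; rewrite /faces_of => /permP wF; apply/permP => p; move: {wF}(wF p).
rewrite /face_corners /= !(last_cat, pairmap_cat, map_cat) /=.
rewrite !(last_cat, pairmap_cat, map_cat, count_cat) /= !count_cat /=.
rewrite ?cats0 ?map_cat /= ?count_cat /= ?invK.
rewrite ?ec ?lc ?ed ?ld.
lia.
Qed.

(** Here both corners lie on one face: it passes from [C] to [D] at the corner between [A] and [B],
    and from [D] back to [C] at the other. The nested defaults of [head] and [last] give the cyclic
    neighbours even if [C] or [D] is empty. *)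
Lemma split_faces z x A B C D F :
    A != [::] -> B != [::] -> C ++ D != [::] -> uniq (A ++ B) ->
    head z B = last (last z D) C \/ last z A = inv (head (head z C) D) ->
    head z A = last (last z C) D \/ last z B = inv (head (head z D) C) ->
    faces_of (A ++ B) ((C ++ D) :: F) ->
  faces_of (A ++ x :: B ++ [:: inv x]) [:: inv x :: C, x :: D & F].
Proof.
move=> A0 B0 CD0 Uw Hx Hy wF.
have [nC nD] : C != [::] /\ D != [::].
  (* If [C] or [D] were empty, both conditions would describe the same corner of the face, so [A]
     and [B] would start with the same side. *)
  suff no_cut q t : (q, t) \in corners (C ++ D) ->
      head z B = q \/ last z A = inv t -> head z A = q \/ last z B = inv t ->
      False.
    split; apply/eqP => e; move: Hx Hy CD0 no_cut; rewrite e ?cats0 /=.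
      case: (D) => [|d D'] //= Hx Hy _ /(_ (last d D') d); apply=> //.
      by rewrite in_cons eqxx.
    case: (C) => [|c C'] //= Hx Hy _ /(_ (last c C') c); apply=> //.
    by rewrite in_cons eqxx.
  move=> qt Hx' Hy'.
  have qtF : (q, t) \in flatten [seq corners c | c <- (C ++ D) :: F].
    by rewrite /= mem_cat qt.
  move: A0 B0 Uw wF Hx' Hy'; case: (A) (B) => [|a A'] [|b B'] // _ _ Uw wF.
  rewrite /= => Hx' Hy'.
  have [_ eb] : inv t = last a A' /\ q = b.
    apply: (corner_match Uw wF) => //.
    by rewrite /= last_cat pairmap_cat !(in_cons, mem_cat) eqxx !orbT.
  have [_ ea] : inv t = last b B' /\ q = a.
    apply: (corner_match Uw wF) => //.
    by rewrite /= last_cat !(in_cons, mem_cat) eqxx.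
  by move: Uw; rewrite -ea -eb /= mem_cat mem_head orbT.
move: A0 B0 nC nD Uw Hx Hy wF {CD0}.
case: A B C D => [|a A] [|b B] [|c C] [|d D] // _ _ _ _ Uw /= Hx Hy wF.
have [ed lc] : inv d = last a A /\ last c C = b.
  apply: (corner_match Uw wF) => //.
    by rewrite /= last_cat pairmap_cat !(in_cons, mem_cat) eqxx !orbT.
  by rewrite /= last_cat pairmap_cat !(in_cons, mem_cat) eqxx !orbT.
have [ec ld] : inv c = last b B /\ last d D = a.
  apply: (corner_match Uw wF) => //.
    by rewrite /= last_cat !(in_cons, mem_cat) eqxx.
  by rewrite /= last_cat !(in_cons, mem_cat) eqxx.
move: wF; rewrite /faces_of => /permP wF; apply/permP => p; move: {wF}(wF p).
rewrite /face_corners /= !(last_cat, pairmap_cat, map_cat) /=.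
rewrite !(last_cat, pairmap_cat, map_cat, count_cat) /= !count_cat /=.
rewrite ?cats0 ?map_cat /= ?count_cat /= ?invK.
rewrite ?ec ?lc ?ed ?ld.
lia.
Qed.

(** * Deleting marks from a word and its faces *)

Lemma perm_flatten_faces w F : faces_of w F -> perm_eq (flatten F) w.
Proof.
move=> /(perm_map snd); rewrite -/(unzip2 (corners w)) unzip2_corners.
move=> /permPr <-; rewrite /face_corners -map_comp; elim: F => //= c F IHF.
by rewrite map_cat perm_cat // perm_sym; apply: perm_unzip1_corners.
Qed.

(** Since [inv m = m], the neighbours of [m] in its face match those in the word, so dropping [m]
    from both creates the same new corner. A face consisting of [m] alone would make [m] its own
    neighbour in the word, so no face disappears. *)
Lemma delete_mark_head m w C F : inv m = m -> uniq (m :: w) -> w != [::] ->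
  faces_of (m :: w) ((m :: C) :: F) -> C != [::] /\ faces_of w (C :: F).
Proof.
case: w => // b w mm Uw _ wF.
have lm : (last b w, m) \in corners (m :: b :: w) by rewrite in_cons eqxx.
have mb : (m, b) \in corners (m :: b :: w) by rewrite !in_cons eqxx orbT.
case: C wF => [|c C] wF.
  have mm' : (m, m) \in corners (m :: b :: w).
    by rewrite -[X in (X, _)]mm; apply: mem_face_corners wF _; rewrite in_cons eqxx.
  have e := corners_injr Uw mm' mb.
  by move: Uw; rewrite e /= in_cons eqxx.
have ec : inv c = last b w.
  apply: corners_injl Uw _ lm; apply: mem_face_corners wF _.
  by rewrite /= !in_cons eqxx orbT.
have lc : last c C = b.
  apply: corners_injr Uw _ mb; rewrite -[X in (X, _)]mm.
  by apply: mem_face_corners wF _; rewrite /= !in_cons eqxx.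
split=> //; move: wF; rewrite /faces_of => /permP wF; apply/permP => p.
move: {wF}(wF p); rewrite /face_corners /= !map_cat !count_cat /= mm lc ec.
lia.
Qed.

Lemma delete_mark m A B F : inv m = m -> uniq (A ++ m :: B) -> A ++ B != [::] ->
    all (fun c => c != [::]) F -> faces_of (A ++ m :: B) F ->
  exists G, [/\ size G = size F, all (fun c => c != [::]) G
              & faces_of (A ++ B) G].
Proof.
move=> mm Uw w0 F0 wF.
have: m \in flatten F.
  by rewrite (perm_mem (perm_flatten_faces wF)) mem_cat mem_head orbT.
case/flattenP => c /path.splitPr Fc; case: Fc F0 wF => F1 F2 F0 wF mc.
case/path.splitPr: mc F0 wF => c1 c2 F0 wF.
have {}wF : faces_of (m :: B ++ A) ((m :: c2 ++ c1) :: F1 ++ F2).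
  rewrite -cat_cons -faces_of_rot; apply: perm_faces wF => p.
  rewrite !map_cat !flatten_cat /= !count_cat count_corners_rot /= map_cat.
  by rewrite flatten_cat count_cat; lia.
have {Uw}Uw : uniq (m :: B ++ A).
  by rewrite -cat_cons -(perm_uniq (permEl (perm_catC A _))).
have {}w0 : B ++ A != [::] by move: w0; case: (A) (B) => [|? ?] [].
have [c0 {}wF] := delete_mark_head mm Uw w0 wF.
exists ((c2 ++ c1) :: F1 ++ F2); rewrite faces_of_rot; split=> //.
  by rewrite /= !size_cat /= addnS.
by rewrite /= c0; move: F0; rewrite !all_cat /= => /and3P[-> _ ->].
Qed.

(** [A] is the prefix already scanned by the induction on [B]. *)
Lemma delete_marks (p : pred T) A B F : (forall x, ~~ p x -> inv x = x) ->
    uniq (A ++ B) -> A ++ filter p B != [::] ->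
    all (fun c => c != [::]) F -> faces_of (A ++ B) F ->
  exists G, [/\ size G = size F, all (fun c => c != [::]) G
              & faces_of (A ++ filter p B) G].
Proof.
move=> fix_p; elim: B A F => [|x B IHB] A F Uw w0 F0 wF; first by exists F.
move: w0; rewrite /=; case: ifPn => [_ | px] w0.
  by rewrite -cat_rcons; apply: IHB; rewrite ?cat_rcons.
have w0' : A ++ B != [::] by move: w0; case: (A) (B) => [|? ?] [].
have [G [<- G0 wG]] := delete_mark (fix_p x px) Uw w0' F0 wF.
apply: IHB => //; apply: subseq_uniq Uw.
by rewrite cat_subseq ?subseq_refl ?subseq_cons.
Qed.

(** * Three marked gaps and the insertion of a letter *)

Variables W L R : T.
Hypotheses (invW : inv W = W) (invL : inv L = L).

(* The distribution of the marks over the faces: in [S0] they lie on three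
   different faces, in [Sxy] the marks x and y share a face, and [SWLR] and
   [SWRL] are the two cyclic orders of three marks on one face. *)
Inductive state := S0 | SWL | SWR | SLR | SWLR | SWRL.

Definition marked_faces (st : state) (C D E : seq T) : seq (seq T) :=
  match st with
  | S0 => [:: W :: C; L :: D; R :: E]
  | SWL => [:: W :: C ++ L :: D; R :: E]
  | SWR => [:: W :: C ++ R :: E; L :: D]
  | SLR => [:: W :: C; L :: D ++ R :: E]
  | SWLR => [:: W :: C ++ L :: D ++ R :: E]
  | SWRL => [:: W :: C ++ R :: E ++ L :: D]
  end.

(* The effect of inserting a letter before (if [bw]) or after [W], and its
   inverse before [R] (if [ar]) or after [L]; the boolean returned tells whether
   the genus increases. *)
Definition next_state (st : state) (bw ar : bool) : bool * state :=
  match st with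
  | S0 => (true, if ar then SWR else SWL)
  | SWL => if ar then (true, if bw then SWRL else SWLR)
           else (false, if bw then SWL else S0)
  | SWR => if ar then (false, if bw then S0 else SWR)
           else (true, if bw then SWLR else SWRL)
  | SLR => (true, SWLR)
  | SWLR => (false, if ar (+) bw then SWLR else SLR)
  | SWRL => (false, if bw then SWL else SWR)
  end.

(* The last condition is Euler's formula: the word consists of two sides per
   edge and of the three marks. *)
Definition has_state (st : state) (g : nat) (w : seq T) : Prop :=
  exists C D E F, [/\ faces_of w (marked_faces st C D E ++ F),
    all (fun c => c != [::]) F &
    (size (marked_faces st C D E ++ F)).*2 + g * 4 + 1 = size w].

Lemma has_state_rot st g A B : has_state st g (A ++ B) -> has_state st g (B ++ A).
Proof.
case=> [C [D [E [F [h1 h2 h3]]]]]; exists C, D, E, F.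
by split; rewrite // ?(faces_of_rot B) // h3 !size_cat addnC.
Qed.

(** [at_mark] settles that a list is nonempty or that a cut lies at a mark; [count_faces] compares
    corner counts of two lists of faces, given the cyclic rotations in [H]. *)
Ltac at_mark C E :=
  first [ by case: (C) | by case: (E) | by left; do 3 rewrite ?last_cat /=
        | by right; rewrite ?invW ?invL
        | by right; case: (E); rewrite /= ?invW ?invL ].

Ltac count_faces fcE H :=
  move: H; rewrite !fcE; do 6 rewrite -?catA ?cat_cons ?cat0s; lia.

Lemma has_state_next z st g bw ar A B x :
    uniq (A ++ B) -> A != [::] -> B != [::] ->
    (if bw then head z B == W else last z A == W) ->
    (if ar then head z A == R else last z B == L) ->
    has_state st g (A ++ B) ->
  let: (d, st') := next_state st bw ar in
  has_state st' (d + g) (A ++ x :: B ++ [:: inv x]).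
Proof.
move=> Uw A0 B0 hx hy [C [D [E [F [wF F0 sF]]]]]; set y := inv x.
pose fc F p := count p (flatten [seq corners c | c <- F]).
have fcE c H p : fc (c :: H) p = count p (corners c) + fc H p.
  by rewrite /fc -count_cat.
(* Merging in general form: [X] and [Y] are the affected faces rotated so as to close up at the
   cuts, [G] holds the other faces, and the primed lists describe the result. *)
have mg st' X Y G C' D' E' F' : X != [::] -> Y != [::] ->
    head z B = last z X \/ last z A = inv (head z X) ->
    head z A = last z Y \/ last z B = inv (head z Y) ->
    fc (marked_faces st C D E ++ F) =1 fc [:: X, Y & G] ->
    fc ((x :: X ++ y :: Y) :: G) =1 fc (marked_faces st' C' D' E' ++ F') ->
    all (fun c => c != [::]) F' ->
    size (marked_faces st C D E ++ F) =
      (size (marked_faces st' C' D' E' ++ F')).+1 ->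
  has_state st' (1 + g) (A ++ x :: B ++ [:: y]).
  move=> X0 Y0 Hx Hy eqF eqF' F'0 eqs; exists C', D', E', F'; split=> //.
    apply: perm_faces eqF' _; apply: (merge_faces x A0 B0 X0 Y0 Uw Hx Hy).
    exact: perm_faces eqF _.
  by move: sF; rewrite eqs !(size_cat, size_map) /= size_cat /= => ?; lia.
(* Splitting in the same form: the affected face is rotated so that its two cuts separate [X] from
   [Y]. *)
have sp st' X Y G C' D' E' F' : X ++ Y != [::] ->
    head z B = last (last z Y) X \/ last z A = inv (head (head z X) Y) ->
    head z A = last (last z X) Y \/ last z B = inv (head (head z Y) X) ->
    fc (marked_faces st C D E ++ F) =1 fc [:: X ++ Y & G] ->
    fc [:: y :: X, x :: Y & G] =1 fc (marked_faces st' C' D' E' ++ F') ->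
    all (fun c => c != [::]) F' ->
    (size (marked_faces st C D E ++ F)).+1 =
      size (marked_faces st' C' D' E' ++ F') ->
  has_state st' g (A ++ x :: B ++ [:: y]).
  move=> XY0 Hx Hy eqF eqF' F'0 eqs; exists C', D', E', F'; split=> //.
    apply: perm_faces eqF' _; apply: (split_faces x A0 B0 XY0 Uw Hx Hy).
    exact: perm_faces eqF _.
  by move: sF; rewrite -eqs !size_cat /= size_cat /= => ?; lia.
(* A mark where the letter or its inverse is inserted determines where its face
   is cut; each case lists the cut faces, then the new ones. *)
case: st wF sF mg sp => wF sF mg sp;
  case: bw hx => /eqP hx; case: ar hy => /eqP hy.
- apply: (mg _ (C ++ [:: W]) (E ++ [:: R]) ((L :: D) :: F) (y :: E) D (x :: C) F)
    => [||||p|p||];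
    [at_mark C E ..
    | count_faces fcE (conj (count_corners_rot p [:: W] C)
                              (count_corners_rot p [:: R] E))
    | count_faces fcE (count_corners_rot p (x :: C) (W :: y :: E ++ [:: R]))
    | exact: F0 | by []].
- apply: (mg _ (C ++ [:: W]) (L :: D) ((R :: E) :: F) [:: y] (D ++ x :: C) E F)
    => [||||p|p||];
    [at_mark C E ..
    | count_faces fcE (count_corners_rot p [:: W] C)
    | count_faces fcE (count_corners_rot p (x :: C) (W :: y :: L :: D))
    | exact: F0 | by []].
- apply: (mg _ (W :: C) (E ++ [:: R]) ((L :: D) :: F) (C ++ y :: E) D [:: x] F)
    => [||||p|p||];
    [at_mark C E ..
    | count_faces fcE (count_corners_rot p [:: R] E)
    | count_faces fcE (count_corners_rot p [:: x] (W :: C ++ y :: E ++ [:: R]))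
    | exact: F0 | by []].
- apply: (mg _ (W :: C) (L :: D) ((R :: E) :: F) (C ++ [:: y]) (D ++ [:: x]) E F)
    => [||||p|p||];
    [at_mark C E ..
    | count_faces fcE I
    | count_faces fcE (count_corners_rot p [:: x] (W :: C ++ y :: L :: D))
    | exact: F0 | by []].
- apply: (mg _ (C ++ L :: D ++ [:: W]) (E ++ [:: R]) F (y :: E) D (x :: C) F)
    => [||||p|p||];
    [at_mark C E ..
    | count_faces fcE (conj (count_corners_rot p [:: W] (C ++ L :: D))
                              (count_corners_rot p [:: R] E))
    | count_faces fcE (count_corners_rot p (x :: C ++ L :: D) (W :: y :: E ++ [:: R]))
    | exact: F0 | by []].
- apply: (sp _ (L :: D ++ [:: W]) C ((R :: E) :: F) [:: y] D E ((x :: C) :: F))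
    => [|||p|p||];
    [at_mark C E ..
    | count_faces fcE (count_corners_rot p (W :: C) (L :: D))
    | count_faces fcE (count_corners_rot p (y :: L :: D) [:: W])
    | exact: F0 | by []].
- apply: (mg _ (W :: C ++ L :: D) (E ++ [:: R]) F C (D ++ y :: E) [:: x] F)
    => [||||p|p||];
    [at_mark C E ..
    | count_faces fcE (count_corners_rot p [:: R] E)
    | count_faces fcE (count_corners_rot p [:: x] (W :: C ++ L :: D ++ y :: E ++ [:: R]))
    | exact: F0 | by []].
- apply: (sp _ (L :: D) (W :: C) ((R :: E) :: F) (C ++ [:: x]) (D ++ [:: y]) E F)
    => [|||p|p||];
    [at_mark C E ..
    | count_faces fcE (count_corners_rot p (W :: C) (L :: D))
    | count_faces fcE (conj (count_corners_rot p [:: y] (L :: D))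
                              (count_corners_rot p [:: x] (W :: C)))
    | exact: F0 | by []].
- apply: (sp _ (E ++ [:: W]) (C ++ [:: R]) ((L :: D) :: F) (y :: E) D (x :: C) F)
    => [|||p|p||];
    [at_mark C E ..
    | count_faces fcE (count_corners_rot p (W :: C ++ [:: R]) E)
    | count_faces fcE (conj (count_corners_rot p (y :: E) [:: W])
                              (count_corners_rot p (x :: C) [:: R]))
    | exact: F0 | by []].
- apply: (mg _ (C ++ R :: E ++ [:: W]) (L :: D) F [:: y] (D ++ x :: C) E F)
    => [||||p|p||];
    [at_mark C E ..
    | count_faces fcE (count_corners_rot p [:: W] (C ++ R :: E))
    | count_faces fcE (count_corners_rot p (x :: C ++ R :: E) (W :: y :: L :: D))
    | exact: F0 | by []].
- apply: (sp _ E (W :: C ++ [:: R]) ((L :: D) :: F) C D [:: x] ((y :: E) :: F))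
    => [|||p|p||];
    [at_mark C E ..
    | count_faces fcE (count_corners_rot p (W :: C ++ [:: R]) E)
    | count_faces fcE (count_corners_rot p [:: x] (W :: C ++ [:: R]))
    | exact: F0 | by []].
- apply: (mg _ (W :: C ++ R :: E) (L :: D) F C (D ++ [:: x]) (E ++ [:: y]) F)
    => [||||p|p||];
    [at_mark C E ..
    | count_faces fcE I
    | count_faces fcE (count_corners_rot p [:: x] (W :: C ++ R :: E ++ y :: L :: D))
    | exact: F0 | by []].
- apply: (mg _ (C ++ [:: W]) (E ++ L :: D ++ [:: R]) F (y :: E) D (x :: C) F)
    => [||||p|p||];
    [at_mark C E ..
    | count_faces fcE (conj (count_corners_rot p [:: W] C)
                              (count_corners_rot p (L :: D ++ [:: R]) E))
    | count_faces fcE (count_corners_rot p (x :: C) (W :: y :: E ++ L :: D ++ [:: R]))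
    | exact: F0 | by []].
- apply: (mg _ (C ++ [:: W]) (L :: D ++ R :: E) F [:: y] D (E ++ x :: C) F)
    => [||||p|p||];
    [at_mark C E ..
    | count_faces fcE (count_corners_rot p [:: W] C)
    | count_faces fcE (count_corners_rot p (x :: C) (W :: y :: L :: D ++ R :: E))
    | exact: F0 | by []].
- apply: (mg _ (W :: C) (E ++ L :: D ++ [:: R]) F (C ++ y :: E) D [:: x] F)
    => [||||p|p||];
    [at_mark C E ..
    | count_faces fcE (count_corners_rot p (L :: D ++ [:: R]) E)
    | count_faces fcE (count_corners_rot p [:: x] (W :: C ++ y :: E ++ L :: D ++ [:: R]))
    | exact: F0 | by []].
- apply: (mg _ (W :: C) (L :: D ++ R :: E) F (C ++ [:: y]) D (E ++ [:: x]) F)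
    => [||||p|p||];
    [at_mark C E ..
    | count_faces fcE I
    | count_faces fcE (count_corners_rot p [:: x] (W :: C ++ y :: L :: D ++ R :: E))
    | exact: F0 | by []].
- apply: (sp _ (E ++ [:: W]) (C ++ L :: D ++ [:: R]) F (y :: E) D (x :: C) F)
    => [|||p|p||];
    [at_mark C E ..
    | count_faces fcE (count_corners_rot p (W :: C ++ L :: D ++ [:: R]) E)
    | count_faces fcE (conj (count_corners_rot p (y :: E) [:: W])
                              (count_corners_rot p (x :: C) (L :: D ++ [:: R])))
    | exact: F0 | by []].
- apply: (sp _ (L :: D ++ R :: E ++ [:: W]) C F [:: y] D E ((x :: C) :: F))
    => [|||p|p||];
    [at_mark C E ..
    | count_faces fcE (count_corners_rot p (W :: C) (L :: D ++ R :: E))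
    | count_faces fcE (count_corners_rot p (y :: L :: D ++ R :: E) [:: W])
    | exact: F0 | by []].
- apply: (sp _ E (W :: C ++ L :: D ++ [:: R]) F C D [:: x] ((y :: E) :: F))
    => [|||p|p||];
    [at_mark C E ..
    | count_faces fcE (count_corners_rot p (W :: C ++ L :: D ++ [:: R]) E)
    | count_faces fcE (count_corners_rot p [:: x] (W :: C ++ L :: D ++ [:: R]))
    | exact: F0 | by []].
- apply: (sp _ (L :: D ++ R :: E) (W :: C) F (C ++ [:: x]) D (E ++ [:: y]) F)
    => [|||p|p||];
    [at_mark C E ..
    | count_faces fcE (count_corners_rot p (W :: C) (L :: D ++ R :: E))
    | count_faces fcE (conj (count_corners_rot p [:: y] (L :: D ++ R :: E))
                              (count_corners_rot p [:: x] (W :: C)))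
    | exact: F0 | by []].
- apply: (sp _ (E ++ L :: D ++ [:: W]) (C ++ [:: R]) F (y :: E) D (x :: C) F)
    => [|||p|p||];
    [at_mark C E ..
    | count_faces fcE (count_corners_rot p (W :: C ++ [:: R]) (E ++ L :: D))
    | count_faces fcE (conj (count_corners_rot p (y :: E ++ L :: D) [:: W])
                              (count_corners_rot p (x :: C) [:: R]))
    | exact: F0 | by []].
- apply: (sp _ (L :: D ++ [:: W]) (C ++ R :: E) F [:: y] D (E ++ x :: C) F)
    => [|||p|p||];
    [at_mark C E ..
    | count_faces fcE (count_corners_rot p (W :: C ++ R :: E) (L :: D))
    | count_faces fcE (conj (count_corners_rot p (y :: L :: D) [:: W])
                              (count_corners_rot p (x :: C) (R :: E)))
    | exact: F0 | by []].
- apply: (sp _ (E ++ L :: D) (W :: C ++ [:: R]) F C (D ++ y :: E) [:: x] F)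
    => [|||p|p||];
    [at_mark C E ..
    | count_faces fcE (count_corners_rot p (W :: C ++ [:: R]) (E ++ L :: D))
    | count_faces fcE (conj (count_corners_rot p (y :: E) (L :: D))
                              (count_corners_rot p [:: x] (W :: C ++ [:: R])))
    | exact: F0 | by []].
- apply: (sp _ (L :: D) (W :: C ++ R :: E) F C (D ++ [:: y]) (E ++ [:: x]) F)
    => [|||p|p||];
    [at_mark C E ..
    | count_faces fcE (count_corners_rot p (W :: C ++ R :: E) (L :: D))
    | count_faces fcE (conj (count_corners_rot p [:: y] (L :: D))
                              (count_corners_rot p [:: x] (W :: C ++ R :: E)))
    | exact: F0 | by []].
Qed.

End Faces.

(** * Faces and vertices of the surface *)

(** The roots represent the classes, and [h] maps them bijectively onto its codomain. *)
Lemma n_comp_fibers (X : finType) (e : rel X) k (h : X -> 'I_k) :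
  symmetric e -> (forall u v, connect e u v = (h u == h v)) ->
  (forall i, exists u, h u = i) -> n_comp e predT = k.
Proof.
move=> es eh hs; have ec := sym_connect_sym es.
rewrite -[RHS]card_ord -cardsT.
have <- : [set h u | u in roots e] = [set: 'I_k].
  apply/setP => i; rewrite !inE; have [u <-] := hs i.
  apply/imsetP; exists (root e u); first exact: roots_root.
  by apply/eqP; rewrite -eh connect_root.
rewrite card_in_imset.
  by rewrite /n_comp_mem; apply: eq_card => u; rewrite !inE andbT.
move=> u v /eqP ru /eqP rv /eqP; rewrite -eh => /(rootP ec).
by rewrite ru rv.
Qed.

Section Vertices.

Variables (T : eqType) (inv : T -> T) (f : side -> T).
Hypotheses (invK : involutive inv) (f_inj : injective f).
Hypothesis f_inv : forall s, f (inv_side s) = inv (f s).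

Variables (w : word) (F : seq (seq T)).
Hypotheses (Uw : uniq w) (F0 : all (fun c => c != [::]) F).
Hypothesis wF : faces_of inv (map f w) F.

Lemma glued_sym : symmetric (@glued w).
Proof. by move=> u v; rewrite /glued orbC. Qed.

Lemma corners_nth (A : eqType) (x0 : A) (s : seq A) i : i < size s ->
  nth (x0, x0) (corners s) i = (nth x0 s ((i + size s).-1 %% size s), nth x0 s i).
Proof.
case: s => // a s; rewrite [corners _]/= [size _]/= => si.
rewrite -[LHS]/(nth _ (pairmap pair (last a s) (a :: s)) i).
rewrite (nth_pairmap x0) //; congr pair; case: i si => [|i] si.
  by rewrite add0n modn_small //= (last_nth x0).
by rewrite /= modnDr modn_small // ltnW.
Qed.

Lemma size_corners (A : eqType) (s : seq A) : size (corners s) = size s.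
Proof. by rewrite -[in RHS](unzip2_corners s) size_map. Qed.

Lemma corners_side (v : 'I_(size w)) :
  (f (side_at (ord_pred v)), f (side_at v)) \in corners (map f w).
Proof.
have x0 := f (side_at v).
rewrite /side_at !(tnth_nth (side_at v)) /=.
have vs : v < size (map f w) by rewrite size_map.
have pv : (v + size w).-1 %% size w < size w.
  by rewrite ltn_pmod // (leq_ltn_trans _ (ltn_ord v)).
have := corners_nth x0 vs; rewrite size_map !(nth_map (side_at v)) // => <-.
by apply: mem_nth; rewrite size_corners.
Qed.

Lemma exists_side x : x \in flatten F -> exists u : 'I_(size w), x = f (side_at u).
Proof.
rewrite (perm_mem (perm_flatten_faces wF)) => /mapP[s /(nthP s)[i iw <-] ->].
by exists (Ordinal iw); rewrite /side_at (tnth_nth s).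
Qed.

Lemma side_in_faces (u : 'I_(size w)) : f (side_at u) \in flatten F.
Proof.
by rewrite (perm_mem (perm_flatten_faces wF)) map_f // /side_at mem_tnth.
Qed.

Lemma side_at_inj : injective (@side_at w).
Proof.
move=> u v; rewrite /side_at !(tnth_nth (side_at u)) /= => /eqP.
by rewrite nth_uniq // => /eqP/val_inj.
Qed.

(** A corner is represented by the side starting there. If side [u] follows side [v] in a face, its
    inverse precedes [v] in the word, which is an identification of [u] with the side before [v]. *)
Lemma glued_face (u v : 'I_(size w)) :
  (f (side_at v), f (side_at u)) \in flatten [seq corners c | c <- F] ->
  glued u v.
Proof.
move=> /(mem_face_corners wF) uv; have vv := corners_side v.
have Ufw : uniq (map f w) by rewrite map_inj_uniq.
have /eqP := corners_injl Ufw uv vv; rewrite -f_inv => /eqP/f_inj e.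
by rewrite /glued /identified -e /inv_side /= negbK -surjective_pairing eqxx.
Qed.

Lemma identified_face (u v : 'I_(size w)) : identified u (ord_pred v) ->
  (f (side_at v), f (side_at u)) \in flatten [seq corners c | c <- F].
Proof.
move=> /eqP e; have := corners_side v.
rewrite -(perm_mem wF) => /mapP[[s t] st /= [et es]]; rewrite es.
by rewrite e f_inv et invK.
Qed.

Let h (u : 'I_(size w)) := find (fun c => f (side_at u) \in c) F.

Lemma has_h (u : 'I_(size w)) : has (fun c => f (side_at u) \in c) F.
Proof. by have /flattenP[c cF uc] := side_in_faces u; apply/hasP; exists c. Qed.

Lemma h_lt u : h u < size F.
Proof. by rewrite -has_find has_h. Qed.

Lemma uniq_faces i j x : x \in nth [::] F i -> x \in nth [::] F j -> i = j.
Proof.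
have: uniq (flatten F).
  by rewrite (perm_uniq (perm_flatten_faces wF)) map_inj_uniq.
have memF (G : seq (seq T)) k : x \in nth [::] G k -> x \in flatten G.
  move=> xk; apply/flattenP; exists (nth [::] G k) => //; apply: mem_nth.
  by case: ltnP xk => // /(nth_default [::]) ->.
elim: F i j => [|c G IHG] [|i] [|j] //=; rewrite cat_uniq.
- by move=> /and3P[_ /hasPn cG _] xc /memF/cG; rewrite xc.
- by move=> /and3P[_ /hasPn cG _] /memF/cG/negbTE ->.
- by move=> /and3P[_ _ UG] xi xj; rewrite (IHG i j).
Qed.

Lemma mem_h (u : 'I_(size w)) : f (side_at u) \in nth [::] F (h u).
Proof. exact: (nth_find [::] (has_h u)). Qed.

Lemma face_connect x c (u v : 'I_(size w)) :
  {subset pairmap pair x c <= flatten [seq corners c | c <- F]} ->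
  x = f (side_at u) -> f (side_at v) \in x :: c -> connect (@glued w) u v.
Proof.
elim: c x u => [|y c IHc] x u sub xu.
  by rewrite xu inE => /eqP/f_inj/side_at_inj->; apply: connect0.
rewrite in_cons => /orP[/eqP|vc].
  by rewrite xu => /f_inj/side_at_inj->; apply: connect0.
have xy : (x, y) \in flatten [seq corners c | c <- F].
  by apply: sub; rewrite mem_head.
have [d dF /corners_mem[_ yd]] : exists2 d, d \in F & (x, y) \in corners d.
  by have /flattenP[_ /mapP[d dF ->] ?] := xy; exists d.
have [u' yu'] : exists u' : 'I_(size w), y = f (side_at u').
  by apply: exists_side; apply/flattenP; exists d.
apply: (@connect_trans _ _ u').
  by apply: connect1; rewrite glued_sym glued_face // -yu' -xu.
by apply: IHc yu' vc => q qc; apply: sub; rewrite in_cons qc orbT.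
Qed.

(** The index [h] of the face through a corner is constant under gluing, because identified sides
    are consecutive in a face. Conversely, a walk along a face passes through glued corners only,
    and nonempty faces make [h] surjective. *)
Lemma nb_vertices_faces : nb_vertices w = size F.
Proof.
apply: (@n_comp_fibers _ _ _ (fun u => Ordinal (h_lt u))); first exact: glued_sym.
  move=> u v; apply/idP/eqP => [|[e]].
    have h_id u1 u2 : identified u1 (ord_pred u2) -> h u1 = h u2.
      move=> /identified_face/flattenP[_ /mapP[c /(nthP [::])[i iF <-] ->]].
      move=> /corners_mem[u2c u1c].
      by rewrite (uniq_faces (mem_h u1) u1c) (uniq_faces (mem_h u2) u2c).
    case/connectP => p; elim: p u => [|u' p IHp] u /=; first by move=> _ ->.
    case/andP => uu' pp /(IHp _ pp) <-; apply: val_inj => /=.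
    by case/orP: uu' => /h_id.
  move: (mem_h u) (mem_h v) (mem_nth [::] (h_lt u)); rewrite -e.
  set c := nth _ _ _ => uc vc cF.
  have: {subset corners c <= flatten [seq corners c | c <- F]}.
    by move=> q qc; apply/flattenP; exists (corners c) => //; apply: map_f.
  case: c uc vc cF => // x d xd1 xd2 dF sub.
  have [t xt] : exists t : 'I_(size w), x = f (side_at t).
    apply: exists_side; apply/flattenP.
    by exists (x :: d) => //; rewrite mem_head.
  have cs := face_connect (c := d) _ xt.
  have {}sub : {subset pairmap pair x d <= flatten [seq corners c | c <- F]}.
    by move=> q qd; apply: sub; rewrite in_cons qd orbT.
  apply: (connect_trans (y := t)); last exact: cs.
  by rewrite (sym_connect_sym glued_sym) cs.
move=> i; have: nth [::] F i != [::] by apply: (allP F0); apply: mem_nth.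
case ci: (nth [::] F i) => [|x c] // _.
have xc : x \in nth [::] F i by rewrite ci mem_head.
have [|u xu] := @exists_side x.
  by apply/flattenP; exists (nth [::] F i) => //; apply: mem_nth.
by exists u; apply: val_inj => /=; apply: uniq_faces (mem_h u) _; rewrite -xu.
Qed.

End Vertices.

Section Insert.

Variables (T : eqType) (inv : T -> T) (W L R : T).
Hypothesis invK : involutive inv.
Hypotheses (invW : inv W = W) (invL : inv L = L).

Lemma has_state_insert st g (bw ar : bool) r1 r2 u1 u2 x :
    uniq (r1 ++ W :: r2 ++ u1 ++ u2) -> u1 != [::] -> u2 != [::] ->
    (if ar then head W u2 == R else last W u1 == L) ->
    has_state inv W L R st g (r1 ++ W :: r2 ++ u1 ++ u2) ->
  let: (d, st') := next_state st bw ar in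
  has_state inv W L R st' (d + g)
    ((if bw then rcons r1 x else r1) ++ W ::
     (if bw then r2 else x :: r2) ++ u1 ++ inv x :: u2).
Proof.
move=> Uw u10 u20 hy hs.
(* The cyclic word is cut so that the place of [x] is the boundary of [A] and [B], and the place of
   [inv x] is the end of [B]. *)
pose A := if bw then u2 ++ r1 else u2 ++ r1 ++ [:: W].
pose B := if bw then W :: r2 ++ u1 else r2 ++ u1.
have eAB : A ++ B = u2 ++ r1 ++ W :: r2 ++ u1.
  by rewrite /A /B; case: (bw); rewrite -!catA.
have pAB : perm_eq (A ++ B) (r1 ++ W :: r2 ++ u1 ++ u2).
  by rewrite eAB perm_catC -!catA /= -!catA.
have := @has_state_next _ inv invK W L R invW invL W st g bw ar A B x.
rewrite (perm_uniq pAB) Uw => /(_ isT).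
have -> : A != [::] by rewrite /A; case: (u2) u20 => //; case: (bw).
have -> : B != [::] by rewrite /B; case: (bw) => //; case: (r2).
have -> : (if bw then head W B == W else last W A == W).
  by rewrite /A /B; case: (bw) => //; rewrite !last_cat.
have -> : (if ar then head W A == R else last W B == L).
  move: hy; case: ar; first by rewrite /A; case: (u2) u20 => // ? ?; case: (bw).
  rewrite /B; case/lastP: (u1) u10 => // ? ? _.
  by case: (bw); rewrite /= -?rcons_cat !last_rcons.
move=> /(_ isT isT isT isT).
have hAB : has_state inv W L R st g (A ++ B).
  by rewrite eAB; apply: has_state_rot; rewrite -!catA /= -catA.
move/(_ hAB); case: next_state => d st' {}hs.
have : has_state inv W L R st' (d + g)
    (u2 ++ (if bw then rcons r1 x else r1) ++ W ::
     (if bw then r2 else x :: r2) ++ u1 ++ [:: inv x]).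
  by move: hs; rewrite /A /B; case: (bw); rewrite -?cats1 -?catA /= -?catA.
by move/has_state_rot; rewrite -!catA /= -!catA.
Qed.

End Insert.

(** * The ladder words *)

(** The three values of [option bool] are the marks [W], [L] and [R], which [minv] fixes. *)
Definition marked_side : eqType := (side + option bool)%type.

Definition minv (s : marked_side) : marked_side :=
  match s with inl x => inl (inv_side x) | inr m => inr m end.

Notation mW := (inr None : marked_side).
Notation mL := (inr (Some false) : marked_side).
Notation mR := (inr (Some true) : marked_side).

Lemma inv_sideK : involutive inv_side.
Proof. by case=> x b; rewrite /inv_side /= negbK. Qed.

Lemma minvK : involutive minv.
Proof. by case=> // s; rewrite /minv inv_sideK. Qed.

Definition is_side (s : marked_side) : bool := if s is inl _ then true else false.

(** Deleting the marks keeps the number [k] of faces. The size condition then gives [k] vertices and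
    [k + 2g - 1] edges, so the Euler characteristic is [2 - 2g]. *)
Lemma genusE (w : word) st g M : uniq w -> w != [::] -> uniq M ->
    filter is_side M = map inl w -> size M = size w + 3 ->
  has_state minv mW mL mR st g M -> genus w = g.
Proof.
move=> Uw w0 UM eM sM [C [D [E [F [MF F0 sF]]]]].
have fixM x : ~~ is_side x -> minv x = x by case: x.
have [||G [sG G0 wG]] := delete_marks (p := is_side) (A := [::]) fixM UM _ _ MF.
- by rewrite eM; case: (w) w0.
- by rewrite all_cat F0 andbT; case: (st); rewrite /= ?andbT; case: (D); case: (C).
rewrite /= eM in wG.
have inl_inj : injective (inl : side -> marked_side) by move=> x y [].
have nv := nb_vertices_faces minvK inl_inj (fun _ => erefl) Uw G0 wG.
rewrite /genus /euler_char nv sG /nb_edges.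
move: sF; rewrite sM; set k := size _ => sk.
have {sk} -> : (size w)./2 = k + g.*2 - 1.
  have -> : size w = (k + g.*2 - 1).*2 by lia.
  exact: doubleK.
have k0 : 0 < k by rewrite /k; case: (st).
have -> : (2 - (k%:Z - (k + g.*2 - 1)%N%:Z + 1) = g.*2%:Z)%R by lia.
exact: doubleK.
Qed.

Section Words.

Variables (n : nat) (K T : {set 'I_n}).
Implicit Type s : seq 'I_n.

(** The ladder is restricted to the indices in [s], so that it can be built by induction on [s]. A
    new head of [s] enters at the end of the reversed products and at the start of the others, hence
    always next to a mark. *)
Definition ladder1 s : seq marked_side :=
  [seq inl (pos_side (a_ k)) | k <- rev [seq k <- s | k \in K]].
Definition ladder2 s : seq marked_side :=
  [seq inl (pos_side (a_ k)) | k <- s & k \notin K].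
Definition ladder3 s : seq marked_side :=
  [seq inl (neg_side (a_ k)) | k <- rev [seq k <- s | k \in T]].
Definition ladder4 s : seq marked_side :=
  [seq inl (neg_side (a_ k)) | k <- s & k \notin T].

Definition ladder_right (j8 : bool) s : seq marked_side :=
  if j8 then inl (pos_side La) :: ladder3 s ++ mR :: inl (neg_side La) ::
             inl (pos_side Lb) :: mL :: ladder4 s ++ [:: inl (neg_side Lb)]
  else mL :: ladder4 s ++ ladder3 s ++ [:: mR].

Definition ladder_word (j8 : bool) s : seq marked_side :=
  ladder1 s ++ mW :: ladder2 s ++ ladder_right j8 s.

Definition ladder_run (j8 : bool) s : nat * state :=
  foldr (fun k gs => let: (d, st) := next_state gs.2 (k \in K) (k \in T) in
                     (d + gs.1, st))
        (0, if j8 then S0 else SWRL) s.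

Definition extra (j8 : bool) : seq side :=
  if j8 then [:: pos_side La; neg_side La; pos_side Lb; neg_side Lb] else [::].

Lemma perm_ladder_word j8 s :
  perm_eq (ladder_word j8 s)
    ([:: mW; mL; mR] ++ map inl (extra j8 ++ [seq pos_side (a_ k) | k <- s] ++
                                  [seq neg_side (a_ k) | k <- s])).
Proof.
apply/permP => p.
have cP (P : pred 'I_n) (f : 'I_n -> side) :
    count p [seq inl (f k) | k <- s & P k] +
    count p [seq inl (f k) | k <- s & ~~ P k] =
    count p [seq inl x | x <- [seq f k | k <- s]].
  rewrite -map_comp -count_cat -map_cat; apply/permP/perm_map.
  by apply/permPl/perm_filterC.
have /= := cP (fun k => k \in K) (fun k => pos_side (a_ k)).
have /= := cP (fun k => k \in T) (fun k => neg_side (a_ k)).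
rewrite /ladder_word /ladder_right /ladder1 /ladder2 /ladder3 /ladder4.
by case: j8; rewrite /= !count_cat /= !map_cat !count_cat /= ?count_cat /=
  !map_rev !count_rev /= ?count_cat /= ?count_rev => <- <-; lia.
Qed.

Lemma uniq_ladder_word j8 s : uniq s -> uniq (ladder_word j8 s).
Proof.
move=> Us; rewrite (perm_uniq (perm_ladder_word j8 s)) cat_uniq.
have inl_inj : injective (inl : side -> marked_side) by move=> x y [].
have a_inj : injective (@a_ n) by move=> x y [/val_inj].
apply/and3P; split=> //; first by apply/hasPn => _ /mapP[x _ ->].
rewrite map_inj_uniq // cat_uniq; apply/and3P; split; first by case: j8.
  apply/hasPn => x; rewrite mem_cat => xs; case: j8 => //=; move: xs.
  by case/orP => /mapP[k _ ->].
rewrite cat_uniq !map_inj_uniq ?Us ?andbT /=; last 2 first.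
- by move=> x y [/val_inj].
- by move=> x y [/val_inj].
by apply/hasPn => _ /mapP[k _ ->]; apply/mapP => -[].
Qed.

Lemma ladder_right_cons j8 k s : exists u1 u2,
  [/\ ladder_right j8 s = u1 ++ u2,
      ladder_right j8 (k :: s) = u1 ++ inl (neg_side (a_ k)) :: u2,
      u1 != [::] & u2 != [::]] /\
  (if k \in T then head mW u2 == mR else last mW u1 == mL).
Proof.
rewrite /ladder_right /ladder3 /ladder4 /=; case: j8; case kT: (k \in T) => /=.
- rewrite rev_cons map_rcons -cats1 -catA /=.
  by exists (inl (pos_side La) :: ladder3 s), (mR :: inl (neg_side La) ::
     inl (pos_side Lb) :: mL :: ladder4 s ++ [:: inl (neg_side Lb)]).
- exists (inl (pos_side La) :: ladder3 s ++ [:: mR; inl (neg_side La);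
     inl (pos_side Lb); mL]), (ladder4 s ++ [:: inl (neg_side Lb)]).
  rewrite /ladder4 /ladder3 /= -!catA last_cat /=; split=> //; split=> //.
  by case: [seq _ | _ <- _ & _].
- exists (mL :: ladder4 s ++ ladder3 s), [:: mR].
  by rewrite rev_cons map_rcons -cats1 /= -!catA.
- exists [:: mL], (ladder4 s ++ ladder3 s ++ [:: mR]); split=> //; split=> //.
  by rewrite catA; case: (ladder4 s ++ ladder3 s).
Qed.

Lemma ladder_word_state j8 s : uniq s ->
  let: (g, st) := ladder_run j8 s in
  has_state minv mW mL mR st g (ladder_word j8 s).
Proof.
elim: s => [_|k s IHs] /=.
  (* With no ladder letters, S2 has only the marks, on one face in the cyclic order [W], [R], [L].
     For S8 the word [a a^- b b^-] is a sphere with three faces in the ribbon graph, each carrying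
     one mark. *)
  case: j8; last by exists [::], [::], [::], [::].
  by exists [:: inl (pos_side Lb); inl (pos_side La)], [:: inl (neg_side Lb)],
    [:: inl (neg_side La)], [::].
move=> /andP[_ Us].
have [u1 [u2 [[es eks u10 u20] hy]]] := ladder_right_cons j8 k s.
move: (IHs Us) (uniq_ladder_word j8 Us).
rewrite /ladder_word es eks; case: (ladder_run j8 s) => g st /= hs Uw.
have := has_state_insert (inv := minv) minvK erefl erefl (k \in K)
  (inl (pos_side (a_ k))) Uw u10 u20 hy hs.
case: next_state => d st'; rewrite /ladder1 /ladder2 /=.
by case: ifP => kK //=; rewrite rev_cons map_rcons.
Qed.

Definition surface_word (j8 : bool) : word :=
  if j8 then S8_word K T else S2_word K T.

Lemma genus_surface_word j8 : 0 < n ->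
  genus (surface_word j8) = (ladder_run j8 (enum 'I_n)).1.
Proof.
move=> n0; have Us := enum_uniq 'I_n.
have enumE (A : {set 'I_n}) : enum A = [seq k <- enum 'I_n | k \in A].
  by rewrite enumT.
have sides (U : seq side) : filter is_side (map inl U) = map inl U.
  by elim: U => //= x U ->.
have eM : filter is_side (ladder_word j8 (enum 'I_n)) =
    map inl (surface_word j8).
  rewrite /ladder_word /ladder_right /surface_word /S8_word /S2_word.
  rewrite /R1 /R2 /R3 /R4 !enumE /ladder1 /ladder2 /ladder3 /ladder4.
  have mapE (f : 'I_n -> side) (s : seq 'I_n) :
      [seq inl (f k) | k <- s] = map inl (map f s) :> seq marked_side.
    by rewrite -map_comp.
  have notE (A : {set 'I_n}) : [seq k <- enum 'I_n | k \in ~: A] =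
      [seq k <- enum 'I_n | k \notin A].
    by apply: eq_filter => k; rewrite inE.
  rewrite !mapE !notE.
  by case: j8; do 5 rewrite ?filter_cat ?map_cat /=; rewrite !sides ?cats0.
have pM := perm_ladder_word j8 (enum 'I_n).
have sM : size (ladder_word j8 (enum 'I_n)) = size (surface_word j8) + 3.
  rewrite -(count_predC is_side) -size_filter eM size_map; congr addn.
  rewrite (permP pM) count_cat /= -[RHS]addn0; congr addn.
  rewrite count_map; apply/eqP.
  by rewrite eqn0Ngt -has_count -all_predC; apply/allP.
have UM := uniq_ladder_word j8 Us.
have := ladder_word_state j8 Us; case: ladder_run => g st /=.
apply: genusE => //.
  have inl_inj : injective (inl : side -> marked_side) by move=> x y [].
  by rewrite -(map_inj_uniq inl_inj) -eM filter_uniq.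
rewrite -size_eq0 -lt0n -(ltn_add2r 3) -sM (perm_size pM) size_cat /=.
by rewrite size_map !size_cat !size_map -enumT size_enum_ord; lia.
Qed.

End Words.

(** * The transfer system *)

Definition choices : seq (bool * bool) :=
  [:: (true, true); (true, false); (false, true); (false, false)].

Definition choice_step (c : bool * bool) (gs : nat * state) : nat * state :=
  let: (d, st) := next_state gs.2 c.1 c.2 in (d + gs.1, st).

(** Words grow at the end because [foldr] processes the last choice first; removing that choice
    gives a recursion on the initial state. *)
Fixpoint choice_words (n : nat) : seq (seq (bool * bool)) :=
  if n is m.+1 then [seq rcons l c | c <- choices, l <- choice_words m]
  else [:: [::]].

Definition state_count (n : nat) (st : state) (i : nat) : nat :=
  count (fun l => (foldr choice_step (0, st) l).1 == i) (choice_words n).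

Definition shifted_count (d : bool) (f : nat -> nat) (i : nat) : nat :=
  if d then (if i is j.+1 then f j else 0) else f i.

Lemma foldr_choice_step g st l :
  (foldr choice_step (g, st) l).1 = g + (foldr choice_step (0, st) l).1 /\
  (foldr choice_step (g, st) l).2 = (foldr choice_step (0, st) l).2.
Proof.
elim: l => [|c l] /=; first by rewrite addn0.
case: (foldr _ (g, st) l) => g1 st1; case: (foldr _ (0, st) l) => g2 st2 /=.
case=> -> ->; rewrite /choice_step /=; case: next_state => d st' /=.
by rewrite addnCA.
Qed.

Lemma state_countS n st i : state_count n.+1 st i =
  \sum_(c <- choices) let: (d, st') := next_state st c.1 c.2 in
    shifted_count d (state_count n st') i.
Proof.
rewrite /state_count /= !count_cat /= !count_map !big_cons big_nil /=.
have step_count c : count (preim (rcons^~ c)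
      (fun l => (foldr choice_step (0, st) l).1 == i)) (choice_words n) =
    let: (d, st') := next_state st c.1 c.2 in
    shifted_count d (state_count n st') i.
  rewrite /state_count; case e: next_state => [d st'].
  under eq_count => l do rewrite /= foldr_rcons {2}/choice_step e /=
    (foldr_choice_step _ _ _).1 addn0.
  case: d {e}; case: i => [|i] //=.
  by elim: (choice_words n).
by rewrite !step_count.
Qed.

Lemma state_count0 st i : state_count 0 st i = (i == 0).
Proof. by rewrite /state_count /= addn0 eq_sym. Qed.

(** * Pairs of subsets as words of choices *)

Section Codes.

Variable n : nat.

Definition choice_code (KT : {set 'I_n} * {set 'I_n}) : seq (bool * bool) :=
  [seq (k \in KT.1, k \in KT.2) | k <- enum 'I_n].

Lemma choice_code_inj : injective choice_code.
Proof.
move=> [K T] [K' T'] /eq_in_map e.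
by congr pair; apply/setP => k; have [] := e k (mem_enum _ _).
Qed.

Lemma mem_choice_words m l : size l = m -> l \in choice_words m.
Proof.
elim: m l => [|m IHm] l; first by move/size0nil->.
case/lastP: l => // l c; rewrite size_rcons => -[/IHm lm].
by apply: (allpairs_f (fun c l => rcons l c)) lm; case: c => [] [] [].
Qed.

Lemma size_choice_words m : size (choice_words m) = 4 ^ m.
Proof. by elim: m => // m IHm; rewrite size_allpairs IHm expnS. Qed.

(** The coding is injective, and there are [4 ^ n] pairs of subsets as well as [4 ^ n] words. *)
Lemma perm_choice_code :
  perm_eq [seq choice_code KT | KT : {set 'I_n} * {set 'I_n}] (choice_words n).
Proof.
have Uc : uniq [seq choice_code KT | KT : {set 'I_n} * {set 'I_n}].
  by rewrite map_inj_uniq ?enum_uniq //; apply: choice_code_inj.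
have sub : {subset [seq choice_code KT | KT : {set 'I_n} * {set 'I_n}]
            <= choice_words n}.
  move=> _ /mapP[KT _ ->]; apply: mem_choice_words.
  by rewrite size_map size_enum_ord.
have le_size : size (choice_words n) <=
    size [seq choice_code KT | KT : {set 'I_n} * {set 'I_n}].
  rewrite size_map -cardE card_prod -cardsT -powersetT card_powerset cardsT.
  by rewrite card_ord size_choice_words -expnMn.
have [_ e] := uniq_min_size Uc sub le_size.
exact: uniq_perm Uc (leq_size_uniq Uc sub le_size) e.
Qed.

Lemma ladder_run_code j8 KT : ladder_run KT.1 KT.2 j8 (enum 'I_n) =
  foldr choice_step (0, if j8 then S0 else SWRL) (choice_code KT).
Proof. by rewrite /choice_code foldr_map. Qed.

Lemma genus_count_states j8 i : 0 < n ->
  genus_count [seq surface_word KT.1 KT.2 j8 | KT : {set 'I_n} * {set 'I_n}] i =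
  state_count n (if j8 then S0 else SWRL) i.
Proof.
move=> n0; rewrite /state_count -(permP perm_choice_code) /genus_count !count_map.
by apply: eq_count => KT /=; rewrite genus_surface_word // ladder_run_code.
Qed.

End Codes.

(* For [2i <= m] and [0 < m] this is [C(m-i,i) + C(m-1-i,i)]. *)
Fixpoint ladder_coef (m i : nat) : nat :=
  match m, i with
  | 0, 0 => 1
  | 0, _.+1 => 0
  | m'.+1, 0 => 2
  | m'.+1, i'.+1 =>
    if m' is m''.+1 then ladder_coef m' i'.+1 + ladder_coef m'' i' else 0
  end.

Lemma ladder_coefSS m i :
  ladder_coef m.+2 i.+1 = ladder_coef m.+1 i.+1 + ladder_coef m i.
Proof. by []. Qed.

Lemma state_countS0 m i : state_count m.+1 S0 i =
  shifted_count true
    (fun i => 2 * state_count m SWL i + 2 * state_count m SWR i) i.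
Proof. by rewrite state_countS !big_cons big_nil /=; case: i => //= i; lia. Qed.

Lemma state_countSL m i : state_count m.+1 SWL i =
  state_count m SWL i + state_count m S0 i +
  shifted_count true (fun i => state_count m SWRL i + state_count m SWLR i) i.
Proof. by rewrite state_countS !big_cons big_nil /=; case: i => //= [|i]; lia. Qed.

Lemma state_countSR m i : state_count m.+1 SWR i =
  state_count m SWR i + state_count m S0 i +
  shifted_count true (fun i => state_count m SWRL i + state_count m SWLR i) i.
Proof. by rewrite state_countS !big_cons big_nil /=; case: i => //= [|i]; lia. Qed.

Lemma state_countSLR m i : state_count m.+1 SLR i =
  shifted_count true (fun i => 4 * state_count m SWLR i) i.
Proof. by rewrite state_countS !big_cons big_nil /=; case: i => //= [|i]; lia. Qed.

Lemma state_countSWLR m i : state_count m.+1 SWLR i =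
  2 * state_count m SWLR i + 2 * state_count m SLR i.
Proof. by rewrite state_countS !big_cons big_nil /=; lia. Qed.

Lemma state_countSWRL m i : state_count m.+1 SWRL i =
  2 * state_count m SWL i + 2 * state_count m SWR i.
Proof. by rewrite state_countS !big_cons big_nil /=; lia. Qed.

Lemma state_count_sym m i : state_count m SWR i = state_count m SWL i.
Proof.
elim: m i => [|m IHm] i; first by rewrite !state_count0.
by rewrite state_countSL state_countSR IHm.
Qed.

Lemma nat_ind2 (P : nat -> Prop) :
  P 0 -> P 1 -> (forall m, P m -> P m.+1 -> P m.+2) -> forall m, P m.
Proof.
move=> P0 P1 PS m; suff [] : P m /\ P m.+1 by [].
by elim: m => // m [Pm Pm1]; split=> //; apply: PS.
Qed.

(** [SWLR] and [SLR] form a closed subsystem. Eliminating [SLR] leaves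
    [c(m+2,i+1) = 2 c(m+1,i+1) + 8 c(m,i)], which is the recursion of [ladder_coef] scaled by powers
    of two. *)
Lemma state_count_WLR m i : state_count m SWLR i = 2 ^ (m + i) * ladder_coef m i.
Proof.
elim/nat_ind2: m i => [||m IH0 IH1] i.
- by rewrite state_count0; case: i => //= i; rewrite muln0.
- rewrite state_countSWLR !state_count0.
  by case: i => [|i] /=; rewrite ?muln0 ?addn0.
rewrite state_countSWLR state_countSLR IH1; case: i => [|i].
  by rewrite /= !addn0 !expnS; lia.
by rewrite [shifted_count _ _ _]/= IH0 ladder_coefSS !(addSn, addnS, expnS); lia.
Qed.

Lemma state_count_WL0 m : state_count m SWL 0 = ladder_coef m 0.
Proof.
elim/nat_ind2: m => [||m IH0 IH1] //; rewrite state_countSL /=.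
by rewrite IH1 state_countS0 /=.
Qed.

(** The negative term of the closed form stands on the left to stay in the naturals. Eliminating
    [S0], [SWRL] and, by symmetry, [SWR] leaves [c(m+2,i+1) = c(m+1,i+1) + 8 c(m,i) + d(m+1,i)],
    with [d] the count for [SWLR]. *)
Lemma state_count_WLS m i :
  state_count m SWL i.+1 + 8 ^ i * ladder_coef m i =
  2 ^ (m + i) * ladder_coef m i + 8 ^ i.+1 * ladder_coef m i.+1.
Proof.
elim/nat_ind2: m i => [||m IH0 IH1] i.
- by rewrite state_count0 /=; case: i => [|i] //=; rewrite !muln0.
- by rewrite state_countSL /= !state_count0; case: i => [|i]; rewrite /= ?muln0.
rewrite state_countSL state_countS0 ![shifted_count _ _ _]/= state_countSWRL.
rewrite !state_count_sym state_count_WLR.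
case: i => [|i].
  have := IH1 0; rewrite state_count_WL0 ladder_coefSS !(addSn, addnS, expnS) /=.
  lia.
have := IH1 i.+1; have := IH0 i; rewrite !ladder_coefSS !(addSn, addnS, expnS).
nia.
Qed.

(** * Closed forms and monotonicity *)

Lemma ladder_coef_eq0 m i : m < i.*2 -> ladder_coef m i = 0.
Proof.
elim/nat_ind2: m i => [||m IH0 IH1] [|i] // mi.
by rewrite ladder_coefSS IH1 ?IH0 //; lia.
Qed.

(** Division-free form of [C(s+i,i) + C(s+i-1,i)], where [s = m - 2i]. *)
Lemma ladder_coef_fact s i : 0 < s + i ->
  ladder_coef (s + i.*2) i * i`! * s`! = (2 * s + i) * (s + i).-1`!.
Proof.
elim: i s => [|i IHi] s.
  case: s => // s _; rewrite !addn0 /= factS muln1; lia.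
elim: s => [|s IHs] _.
  rewrite add0n doubleS ladder_coefSS ladder_coef_eq0 ?ltnS ?doubleS //.
  case: i IHi => [|i] // /(_ 0 isT); rewrite !add0n /= !muln1 => IHi.
  by rewrite factS mulnCA IHi.
have := IHs (ltn_addl _ (ltn0Sn i)); have := IHi s.+1 (ltn_addr _ (ltn0Sn s)).
have -> : s.+1 + i.+1.*2 = (s + i.*2).+3 by rewrite doubleS !addnS addSn.
have -> : s + i.+1.*2 = (s + i.*2).+2 by rewrite doubleS !addnS.
have -> : s.+1 + i.*2 = (s + i.*2).+1 by [].
have -> : (s.+1 + i).-1 = s + i by [].
have -> : (s + i.+1).-1 = s + i by rewrite addnS.
have -> : (s.+1 + i.+1).-1 = (s + i).+1 by rewrite addnS.
rewrite (ladder_coefSS (s + i.*2).+1) !factS.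
move: (ladder_coef _ _) (ladder_coef _ _) (i`!) (s`!) ((s + i)`!).
move=> A B I S F hB hA.
have -> : (A + B) * (i.+1 * I) * (s.+1 * S) =
    s.+1 * (A * (i.+1 * I) * S) + i.+1 * (B * I * (s.+1 * S)) by lia.
by rewrite hA hB; lia.
Qed.

(* For [m = q + 2j + 3], three consecutive values [ladder_coef m j],
   [ladder_coef m (j+1)], [ladder_coef m (j+2)] are proportional to the weights. *)
Definition weight0 q j :=
  (2 * q + j + 6) * (q + j + 2) * (q + j + 1) * (j + 1) * (j + 2).
Definition weight1 q j :=
  (2 * q + j + 3) * (q + j + 1) * (j + 2) * (q + 2) * (q + 3).
Definition weight2 q j := (2 * q + j) * (q + 3) * (q + 2) * (q + 1) * q.

(** With [E = 2 ^ (q + 3)] this compares the closed forms at [j + 1] and [j + 2]. As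
    [weight0 <= 2 * weight1], the difference of the two sides is monotone in [E], which reduces the
    claim to [E = 32]. *)
Lemma weight_inc q j E : 2 <= q -> j <= q.+1 -> 32 <= E ->
  E * weight0 q j + 16 * weight1 q j <
  2 * E * weight1 q j + 64 * weight2 q j + weight0 q j.
Proof.
move=> q2 jq E32.
suff [h1 h2] : weight0 q j <= 2 * weight1 q j /\
    32 * weight0 q j + 16 * weight1 q j <
    64 * weight1 q j + 64 * weight2 q j + weight0 q j.
  have -> : E = 32 + (E - 32) by lia.
  have := leq_mul (leqnn (E - 32)) h1; lia.
have [j3|j3] := ltnP 2 j.
  (* The substitution removes the constraints: [a] and [t] are arbitrary naturals. *)
  have [a [t [-> ->]]] : exists a t, q = a + t + 2 /\ j = a + 3.
    by exists (j - 3), (q.+1 - j); lia.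
  rewrite /weight0 /weight1 /weight2; split; nia.
have [u ->] : exists u, q = u + 2 by exists (q - 2); lia.
by case: j j3 jq => [|[|[|]]] // _ _;
  rewrite /weight0 /weight1 /weight2; split; nia.
Qed.

(** The reverse comparison. Now [2 * weight1 <= weight0], so for [q >= 2] the power may be replaced
    by a linear lower bound, leaving a polynomial inequality. *)
Lemma weight_dec q j : q + 2 <= j ->
  2 * 2 ^ (q + 3) * weight1 q j + 64 * weight2 q j + weight0 q j <
  2 ^ (q + 3) * weight0 q j + 16 * weight1 q j.
Proof.
move=> qj; have [t ->] : exists t, j = q + 2 + t by exists (j - (q + 2)); lia.
case: q {qj} => [|[|q]]; first by rewrite /weight0 /weight1 /weight2 /=; nia.
  by rewrite /weight0 /weight1 /weight2 /=; nia.
(* The bound is nearly sharp at the start, where it reads [31 <= 32]. *)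
have Eq : 10 * (q.+2 + 1) + 1 <= 2 ^ (q.+2 + 3).
  by elim: q => [|q IHq] //; rewrite (addSn _ 3) expnS; lia.
move: (2 ^ _) Eq => E Eq; set k := q.+2 + 2 + t.
suff [h1 h2] : 2 * weight1 q.+2 k <= weight0 q.+2 k /\
    2 * (10 * (q.+2 + 1) + 1) * weight1 q.+2 k + 64 * weight2 q.+2 k +
      weight0 q.+2 k <
    (10 * (q.+2 + 1) + 1) * weight0 q.+2 k + 16 * weight1 q.+2 k.
  have -> : E = (10 * (q.+2 + 1) + 1) + (E - (10 * (q.+2 + 1) + 1)) by lia.
  have := leq_mul (leqnn (E - (10 * (q.+2 + 1) + 1))) h1; lia.
by rewrite /weight0 /weight1 /weight2 /k; split; nia.
Qed.

(** [M] is a common denominator of the three factorial formulas, for which [s] is [q + 3], [q + 1]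
    and [q - 1]; [Y] is the common factor of their numerators. *)
Lemma ladder_coef_ratios q j : let m := q + j.*2 + 3 in
  exists M Y, [/\ 0 < M, 0 < Y, ladder_coef m j * M = weight0 q j * Y,
    ladder_coef m j.+1 * M = weight1 q j * Y &
    ladder_coef m j.+2 * M = weight2 q j * Y].
Proof.
move=> m; exists ((j + 2)`! * (q + 3)`!), (q + j)`!.
split; rewrite ?muln_gt0 ?fact_gt0 //.
- have /ladder_coef_fact : 0 < q + 3 + j by lia.
  have -> : q + 3 + j.*2 = m by rewrite /m; lia.
  have -> : (q + 3 + j).-1 = (q + j).+2 by lia.
  rewrite addn2 !factS /weight0 => h.
  have -> : ladder_coef m j * (j.+2 * (j.+1 * j`!) * (q + 3)`!) =
    j.+2 * j.+1 * (ladder_coef m j * j`! * (q + 3)`!) by lia.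
  rewrite h; move: (_`!) => F; nia.
- have /ladder_coef_fact : 0 < q.+1 + j.+1 by [].
  have -> : q.+1 + j.+1.*2 = m by rewrite /m; lia.
  have -> : (q.+1 + j.+1).-1 = (q + j).+1 by lia.
  rewrite addn2 addn3 !(factS (q + j)) !(factS q.+2) (factS q.+1) (factS j.+1).
  rewrite /weight1 => h.
  have -> : ladder_coef m j.+1 * (j.+2 * (j.+1)`! * (q.+3 * (q.+2 * (q.+1)`!))) =
    j.+2 * q.+3 * q.+2 * (ladder_coef m j.+1 * (j.+1)`! * (q.+1)`!) by lia.
  rewrite h; move: (_`!) => F; nia.
(* For [q = 0] the third value of [s] would be negative; there both the coefficient and [weight2]
   vanish. *)
case: q @m => [|q] m.
  by rewrite ladder_coef_eq0 /weight2 ?muln0 // /m; lia.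
have /ladder_coef_fact : 0 < q + j.+2 by lia.
have -> : q + j.+2.*2 = m by rewrite /m; lia.
have -> : (q + j.+2).-1 = q.+1 + j by lia.
rewrite addn2 addn3 (factS q.+3) (factS q.+2) (factS q.+1) (factS q) /weight2 => h.
have -> : ladder_coef m j.+2 *
    ((j.+2)`! * (q.+4 * (q.+3 * (q.+2 * (q.+1 * q`!))))) =
    q.+4 * q.+3 * q.+2 * q.+1 * (ladder_coef m j.+2 * (j.+2)`! * q`!) by lia.
rewrite h; move: (_`!) => F; nia.
Qed.

(** Since [m + j = (q + 3) + 3j], the factor [8 ^ j] comes out of both closed forms. *)
Lemma state_count_WLSS q j : let m := q + j.*2 + 3 in let E := 2 ^ (q + 3) in
  state_count m SWL j.+1 + 8 ^ j * ladder_coef m j =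
    8 ^ j * (E * ladder_coef m j + 8 * ladder_coef m j.+1) /\
  state_count m SWL j.+2 + 8 ^ j * (8 * ladder_coef m j.+1) =
    8 ^ j * (2 * E * ladder_coef m j.+1 + 64 * ladder_coef m j.+2).
Proof.
move=> m E; have E8 : 2 ^ (m + j) = E * 8 ^ j.
  by rewrite /E -[8]/(2 ^ 3) -expnM -expnD; congr (2 ^ _); rewrite /m; lia.
have := state_count_WLS m j; have := state_count_WLS m j.+1.
by rewrite addnS !expnS E8; split; lia.
Qed.

Lemma lin_scale (M Y a b c p q r x y z : nat) :
    a * M = p * Y -> b * M = q * Y -> c * M = r * Y ->
  (x * a + y * b + z * c) * M = (x * p + y * q + z * r) * Y.
Proof. by move=> ha hb hc; rewrite !mulnDl -!mulnA ha hb hc. Qed.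

Lemma state_count_inc m i : 9 <= m -> 3 * i <= m.+1 ->
  state_count m SWL i < state_count m SWL i.+1.
Proof.
move=> m9; case: i => [_|j jm].
  have := state_count_WLS m 0; rewrite state_count_WL0.
  have -> : ladder_coef m 0 = 2 by case: (m) m9.
  rewrite addn0 /= mul1n => h.
  have : 2 ^ 9 <= 2 ^ m by rewrite leq_exp2l.
  lia.
(* For [i = j + 1], the bound [3i <= m + 1] is [j <= q + 1], and [9 <= m] then forces [2 <= q]. *)
have [q mq q2] : exists2 q, m = q + j.*2 + 3 & 2 <= q /\ j <= q.+1.
  by exists (m - j.*2 - 3); lia.
have [M [Y [M0 Y0 h0 h1 h2]]] := ladder_coef_ratios q j.
have [g1 g2] := state_count_WLSS q j; rewrite -mq in g1 g2 h0 h1 h2.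
have E32 : 32 <= 2 ^ (q + 3) by rewrite -[32]/(2 ^ 5) leq_exp2l //; lia.
have := weight_inc q2.1 q2.2 E32; move: (2 ^ _) E32 g1 g2 => E _ g1 g2.
have eL := lin_scale E 16 0 h0 h1 h2.
have eR := lin_scale (2 * E) 64 1 h1 h2 h0.
rewrite !mul1n ?mul0n ?addn0 in eL eR.
rewrite -(ltn_pmul2r Y0) -eL -eR ltn_pmul2r // => {h0 h1 h2 eL eR}.
have e0 : 0 < 8 ^ j by rewrite expn_gt0.
rewrite -(ltn_pmul2l e0) => h; lia.
Qed.

Lemma state_count_dec m i : m.+2 <= 3 * i -> i.*2.+1 <= m ->
  state_count m SWL i.+1 < state_count m SWL i.
Proof.
case: i => [|j] //.
(* Here [m + 2 <= 3i] becomes [q + 2 <= j], the complement of the range of the increasing case. *)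
move=> mj jm; have [q mq qj] : exists2 q, m = q + j.*2 + 3 & q + 2 <= j.
  by exists (m - j.*2 - 3); lia.
have [M [Y [M0 Y0 h0 h1 h2]]] := ladder_coef_ratios q j.
have [g1 g2] := state_count_WLSS q j; rewrite -mq in g1 g2 h0 h1 h2.
have := weight_dec qj; move: (2 ^ _) g1 g2 => E g1 g2.
have eL := lin_scale E 16 0 h0 h1 h2.
have eR := lin_scale (2 * E) 64 1 h1 h2 h0.
rewrite !mul1n ?mul0n ?addn0 in eL eR.
rewrite -(ltn_pmul2r Y0) -eL -eR ltn_pmul2r // => {h0 h1 h2 eL eR}.
have e0 : 0 < 8 ^ j by rewrite expn_gt0.
rewrite -(ltn_pmul2l e0) => h; lia.
Qed.

Lemma ladder_coef_gt0 m i : i.*2 <= m -> 0 < ladder_coef m i.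
Proof.
elim/nat_ind2: m i => [||m IH0 IH1] [|i] // im.
by rewrite ladder_coefSS addn_gt0 IH0 ?orbT //; move: im; rewrite doubleS !ltnS.
Qed.

Lemma state_count_WL_gt0 m i : (0 < state_count m SWL i) = (i.*2 <= m.+1).
Proof.
case: i => [|i]; first by rewrite state_count_WL0 ladder_coef_gt0.
have := state_count_WLS m i; have [mi|im] := leqP i.+1.*2 m.+1.
  have c0 : 0 < ladder_coef m i by apply: ladder_coef_gt0; lia.
  have E2 : 2 * 8 ^ i <= 2 ^ (m + i).
    by rewrite -[8]/(2 ^ 3) -expnM -expnS leq_exp2l //; lia.
  have e0 : 0 < 8 ^ i * ladder_coef m i by rewrite muln_gt0 expn_gt0.
  have := leq_mul E2 (leqnn (ladder_coef m i)); lia.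
rewrite (@ladder_coef_eq0 m i.+1) ?muln0 ?addn0; last by lia.
have [mi|mi] := ltnP m i.*2; first by rewrite (ladder_coef_eq0 mi) !muln0; lia.
(* Only [m = 2i] remains; there the first term cancels the subtracted one. *)
have -> : 2 ^ (m + i) = 8 ^ i.
  by rewrite -[8]/(2 ^ 3) -expnM; congr (2 ^ _); lia.
lia.
Qed.

(** * From strict monotonicity to unimodality and the peak *)

Lemma genus_bounds S q r : q <= r ->
    (forall i, (0 < genus_count S i) = (q <= i <= r)) ->
  min_genus S = q /\ max_genus S = r.
Proof.
move=> qr countP.
have genP w : w \in S -> q <= genus w <= r.
  by move=> Sw; rewrite -countP -has_count; apply/hasP; exists w.
have ex i : q <= i <= r -> exists2 w, w \in S & genus w = i.
  by rewrite -countP -has_count => /hasP[w Sw /eqP]; exists w.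
have maxE : max_genus S = r.
  apply/eqP; rewrite eqn_leq; apply/andP; split.
    by apply/bigmax_leqP_seq => w /genP/andP[].
  have [|w Sw <-] := ex r; first by rewrite qr leqnn.
  exact: leq_bigmax_seq.
split=> //; apply/eqP; rewrite eqn_leq; apply/andP; split; last first.
  rewrite /min_genus maxE big_seq.
  elim/big_ind: _ => // [x y qx qy|w /genP/andP[]//].
  by rewrite leq_min qx.
have [|w Sw <-] := ex q; first by rewrite leqnn.
rewrite /min_genus; move: (max_genus S) => d; elim: (S) Sw => // v s IHs.
rewrite in_cons big_cons geq_min.
by case/orP => [/eqP-> | /IHs->]; rewrite ?leqnn ?orbT.
Qed.

Lemma strict_peak f q r p : q <= p <= r ->
    (forall i, q <= i < p -> f i < f i.+1) ->
    (forall i, p <= i < r -> f i.+1 < f i) ->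
  is_peak f q r p.
Proof.
move=> /andP[qp pr] inc dec; split=> //; split.
- by move=> i qi ip; apply/ltnW/inc; rewrite qi ltnW.
- by case: p {pr dec} qp inc => // p qp inc qp'; apply: inc; rewrite -ltnS qp' /=.
- by move=> i; rewrite -eqn_leq => /eqP->.
- by move=> pr'; apply: dec; rewrite leqnn.
- by move=> i pi ir; apply/ltnW/dec; rewrite ltnW.
Qed.

(** The shift lets one sequence [f] serve both families, with [d = 0] for S2 and [d = 1] for S8. *)
Lemma strict_peak_shift d S f q r p : q <= p <= r ->
    (forall i, genus_count S i = if i < d then 0 else f (i - d)) ->
    (forall i, (0 < f i) = (q <= i <= r)) ->
    (forall i, q <= i < p -> f i < f i.+1) ->
    (forall i, p <= i < r -> f i.+1 < f i) ->
  genus_distribution_unimodal S /\ genus_distribution_peak S (p + d).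
Proof.
move=> /[dup] /andP[qp pr] qpr SE f_gt0 inc dec.
have [minE maxE] : min_genus S = q + d /\ max_genus S = r + d.
  apply: genus_bounds => [|i]; first by rewrite leq_add2r; apply: leq_trans pr.
  rewrite SE; case: (ltnP i d) => di; first lia.
  by rewrite f_gt0; lia.
have SE' i : d <= i -> genus_count S i = f (i - d) by rewrite SE ltnNge => ->.
have peakS : genus_distribution_peak S (p + d).
  rewrite /genus_distribution_peak minE maxE.
  apply: strict_peak => [|i iP|i iP]; first by rewrite !leq_add2r.
  - by rewrite !SE' ?subSn ?inc //; lia.
  - by rewrite !SE' ?subSn ?dec //; lia.
by split=> //; exists (p + d), (p + d).
Qed.

(** A form fit for evaluation in the small cases, in place of counting over [4 ^ m] words. *)
Definition WL_closed m i :=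
  if i is j.+1 then 2 ^ (m + j) * ladder_coef m j + 8 ^ j.+1 * ladder_coef m j.+1
                    - 8 ^ j * ladder_coef m j
  else ladder_coef m 0.

Lemma state_count_WLE m i : state_count m SWL i = WL_closed m i.
Proof.
by case: i => [|i]; rewrite /WL_closed ?state_count_WL0 // -state_count_WLS addnK.
Qed.

Lemma state_count_small_inc m i : 2 <= m <= 8 -> i < p2 m.+1 ->
  state_count m SWL i < state_count m SWL i.+1.
Proof.
move=> m28 ip.
have check : all (fun m => all (fun i => WL_closed m i < WL_closed m i.+1)
    (iota 0 (p2 m.+1))) (iota 2 7) by vm_compute.
have mi : m \in iota 2 7 by rewrite mem_iota.
have ii : i \in iota 0 (p2 m.+1) by rewrite mem_iota.
by have := allP (allP check m mi) i ii; rewrite -!state_count_WLE.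
Qed.

Lemma p2_inc m i : 2 <= m -> i < p2 m.+1 ->
  state_count m SWL i < state_count m SWL i.+1.
Proof.
move=> m2 ip; have [m9|m8] := leqP 9 m.
  (* For [n = m + 1 >= 10], being below [n %/ 3 + 1] means exactly [3i <= m + 1]. *)
  apply: state_count_inc => //; move: ip; rewrite /p2; case: (leqP m.+1 8); [lia|].
  case: eqP; lia.
by apply: state_count_small_inc => //; rewrite m2.
Qed.

Lemma state_count_small_dec m i : 2 <= m <= 8 -> p2 m.+1 <= i -> i.*2.+1 <= m ->
  state_count m SWL i.+1 < state_count m SWL i.
Proof.
move=> m28 ip im.
have check : all (fun m => all (fun i => (p2 m.+1 <= i) ==> (i.*2.+1 <= m) ==>
  (WL_closed m i.+1 < WL_closed m i)) (iota 0 4)) (iota 2 7) by vm_compute.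
have mi : m \in iota 2 7 by rewrite mem_iota.
have ii : i \in iota 0 4 by rewrite mem_iota; lia.
by have := allP (allP check m mi) i ii; rewrite ip im -!state_count_WLE.
Qed.

Lemma p2_dec m i : 2 <= m -> p2 m.+1 <= i -> i.*2.+1 <= m ->
  state_count m SWL i.+1 < state_count m SWL i.
Proof.
move=> m2 ip im; have [m9|m8] := leqP 9 m.
  apply: state_count_dec => //; move: ip; rewrite /p2.
  by case: (leqP m.+1 8); [lia | case: eqP; lia].
by apply: state_count_small_dec => //; rewrite m2.
Qed.

Theorem corollary3p11 (n : nat) (hn : 3 <= n) :
  (genus_distribution_unimodal (S2 n) /\ genus_distribution_peak (S2 n) (p2 n))
  /\
  (genus_distribution_unimodal (S8 n) /\ genus_distribution_peak (S8 n) (p8 n)).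
Proof.
case: n hn => // m m2; have n0 : 0 < m.+1 by [].
(* The first letter leads from [SWRL] or [S0] to [SWL] or [SWR] in two ways each, and these two
   states have equal counts; from [S0] the genus also rises by one. *)
pose f i := 4 * state_count m SWL i.
have f_gt0 i : (0 < f i) = (0 <= i <= m.+1./2).
  by rewrite muln_gt0 state_count_WL_gt0 /=; lia.
have inc i : 0 <= i < p2 m.+1 -> f i < f i.+1.
  by move=> ip; rewrite ltn_pmul2l // p2_inc.
have dec i : p2 m.+1 <= i < m.+1./2 -> f i.+1 < f i.
  by move=> /andP[ip im]; rewrite ltn_pmul2l // p2_dec //; lia.
have p2_le : 0 <= p2 m.+1 <= m.+1./2.
  by rewrite /p2; case: (leqP m.+1 8); [lia | case: eqP; lia].
split.
  rewrite -[p2 _]addn0; apply: strict_peak_shift p2_le _ f_gt0 inc dec => i.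
  rewrite subn0 /f; have /= := genus_count_states false i n0.
  by rewrite state_countSWRL state_count_sym => ->; lia.
have -> : p8 m.+1 = p2 m.+1 + 1.
  by rewrite /p8 /p2; case: (leqP m.+1 8) => ?; [lia | case: eqP; lia].
apply: strict_peak_shift p2_le _ f_gt0 inc dec => i.
have /= := genus_count_states true i n0.
rewrite state_countS0 => ->; case: i => [|i] //=.
by rewrite subn1 succnK state_count_sym /f; lia.
Qed.
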